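(* Let $k$ be a field, let $G = (V_G,E_G)$ be a tree on the $n$ vertices $V_G=\{x_1,\ldots,x_n\}$, and fix any integer $t \geq 1$. Then the partial $t$-cover ideal $J_t(G) \subseteq R = k[x_1,\ldots,x_n]$ satisfies the persistence property. Furthermore, \[{\rm astab}(J_t(G)) = \left\{\begin{array}{ll} 1 & \mbox{if } t=1 \\ \min\{s \in \mathbb{Z}_{\geq 1} ~|~ s(t-1) \geq \Delta(G) -1 \} & \mbox{if } t > 1, \end{array}\right.\] where $\Delta(G)$ is the maximal degree of $G$, i.e., the largest degree of a vertex of $G$.
   Context: Graphs are finite and simple. A graph is called a tree if it has no induced cycles. For a vertex $x$ of $G$, $N(x)=\{y ~|~ \{x,y\}\in E_G\}$ is its set of neighbours. Vertices $x_i$ are identified with the variables $x_i$ of $R=k[x_1,\ldots,x_n]$. For an integer $t\geq 1$, the partial $t$-cover ideal of $G$ is the monomial ideal \[J_t(G) = \bigcap_{x \in V_G} \left(\bigcap_{\{x_{i_1},\ldots,x_{i_t}\} \subseteq N(x)} \langle x,x_{i_1},\ldots,x_{i_t} \rangle \right),\] where the inner intersection runs over all $t$-element subsets of $N(x)$ (an empty intersection of ideals is $R$). For an ideal $I\subseteq R$, a prime ideal $P$ is an associated prime of $I$ if $P = I:\langle T\rangle$ for some $T\in R$, and ${\rm Ass}(I)$ is the set of all associated primes of $I$. By a theorem of Brodmann there is an integer $s_0 \geq 1$ with ${\rm Ass}(I^s)={\rm Ass}(I^{s_0})$ for all $s\geq s_0$; the least such integer $s_0 \ge 1$ is the index of stability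 ${\rm astab}(I)$. The ideal $I$ satisfies the persistence property if ${\rm Ass}(I^s)\subseteq {\rm Ass}(I^{s+1})$ for all $s\geq 1$. *)

(* Defs.v *)
From HB Require Import structures.
From mathcomp Require Import all_boot all_order all_algebra.
From mathcomp Require Import boolp classical_sets.
From mathcomp Require Import mpoly.

Set Implicit Arguments.
Unset Strict Implicit.
Unset Printing Implicit Defensive.

Import GRing.Theory.
Local Open Scope classical_set_scope.
Local Open Scope ring_scope.

Section Ideals.
Variable R : comNzRingType.
Implicit Types (I J P A : set R) (s : nat).

(* Unlike idealr_closed of ring_quotient, this allows the unit ideal. *)
Definition is_ideal I : Prop :=
  [/\ I 0, forall f g, I f -> I g -> I (f + g) & forall f g, I g -> I (f * g)].

Definition is_prime_ideal P : Prop :=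
  [/\ is_ideal P, P <> setT & forall f g, P (f * g) -> P f \/ P g].

Definition ideal_gen A : set R := smallest is_ideal A.

Definition ideal_mul I J : set R := ideal_gen [set f * g | f in I & g in J].

Definition ideal_pow I s : set R := iter s (ideal_mul I) setT.

Definition ideal_colon I J : set R := [set f | forall g, J g -> I (f * g)].

Definition Ass I : set (set R) :=
  [set P | is_prime_ideal P /\
           exists T : R, P = ideal_colon I (ideal_gen [set T])].

Definition persistence_property I : Prop :=
  forall s, (1 <= s)%N -> Ass (ideal_pow I s) `<=` Ass (ideal_pow I s.+1).

End Ideals.

(* The junk value 0 for the empty set cannot be confused with a genuine
   minimum of a set of positive integers. *)
Definition min_nat (A : set nat) : nat :=
  xget 0%N [set m | A m /\ forall j, A j -> (m <= j)%N].

Definition astab (R : comNzRingType) (I : set R) : nat :=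
  min_nat [set s0 | (1 <= s0)%N /\
    forall s, (s0 <= s)%N -> Ass (ideal_pow I s) = Ass (ideal_pow I s0)].

Section Graphs.
Variable n : nat.
Implicit Types (e : rel 'I_n) (c : seq 'I_n).

Definition is_simple_graph e : Prop := ssrbool.symmetric e /\ irreflexive e.

Definition neighbours e (x : 'I_n) : {set 'I_n} := [set y | e x y]%SET.

Definition max_degree e : nat := (\max_(x < n) #|neighbours e x|)%N.

Definition induced_cycle e c : Prop :=
  [/\ (3 <= size c)%N, uniq c &
      {in c &, forall x y, e x y = (y == next c x) || (x == next c y)}].

(* Connectedness is not required, so every forest is a tree in this sense. *)
Definition is_tree e : Prop := forall c, ~ induced_cycle e c.

Definition partial_cover_ideal (k : fieldType) e (t : nat) :
    set {mpoly k[n]} :=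
  \bigcap_(x in [set: 'I_n])
    \bigcap_(S in [set S : {set 'I_n} | S \subset neighbours e x /\ #|S| = t])
      ideal_gen [set ('X_i : {mpoly k[n]}) | i in [set i | i \in (x |: S)%SET]].

End Graphs.

Arguments partial_cover_ideal {n} k e t _.

(* Main.v *)
Require Import Defs.
From HB Require Import structures.
From mathcomp Require Import all_boot all_order all_algebra.
From mathcomp Require Import boolp classical_sets.
From mathcomp Require Import mpoly.
From mathcomp Require Import ring zify.

(** Let [s >= 1], and let [x] be a vertex.  Covering the neighbourhood of [x]
    alone constrains the exponents [m] of a monomial of the [s]-th power of
    the cover ideal by

      sum over the neighbours i of x of (s - m x - m i) <= (t-1) * (s - m x),

    with truncated subtractions: among the at least [s - m x] covers that
    avoid [x], the neighbour [i] is avoided at least [s - m x - m i] times,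
    and each such cover may avoid at most [t-1] neighbours.  Call this the
    star condition at [x].  It is necessary for every graph.

    For a forest the star conditions at all vertices are also sufficient
    ([star_pow_set]): the power of the ideal is the intersection of the powers
    of the ideals of the stars.  To find [s] covers below [m], one chooses for
    each vertex [v] the set [M v] of the [s - m v] indices of the covers that
    avoid [v].  The vertices are added one by one so that each has at most one
    earlier neighbour ([forest_leaf]); a new [M v] meets the [M x] of that
    neighbour in as few indices as cardinalities permit, and in those indices
    of [M x] which have been used least by the neighbours of [x].  The number
    of neighbours of [x] that use an index of [M x] then varies by at most one
    ([balanced_family_exists]), and the star condition bounds the average of
    these numbers by [t-1], hence all of them ([load_le]).

    The associated primes of a monomial ideal are the colon ideals by
    monomials that are generated by variables ([ass_monomialP]).  With the
    star conditions, such colon ideals can be computed: the associated primes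
    of the [s]-th power are generated by the sets made of a vertex [x] and of
    [r] neighbours of [x] with [t <= r <= (t-1) * s + 1]
    ([ass_pow_partial_cover]).  The range of [r] grows with [s], which is
    persistence, and the associated primes are stable once the upper bound
    has reached the maximal degree, or at once if [t = 1]. *)

(** * Forests *)

Section Forests.
Import boot.fintype boot.finset.
Local Set Implicit Arguments.
Local Unset Strict Implicit.
Variables (n : nat) (e : rel 'I_n).
Hypotheses (graph_e : is_simple_graph e) (tree_e : is_tree e).
Implicit Types (p c : seq 'I_n) (A : {set 'I_n}) (x y v : 'I_n).

Let e_sym : ssrbool.symmetric e := graph_e.1.
Let e_irr : irreflexive e := graph_e.2.

Definition induced_path x0 p : Prop :=
  uniq p /\ forall i j, i < size p -> j < size p ->
    e (nth x0 p i) (nth x0 p j) = (i == j.+1) || (j == i.+1).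

Lemma next_nth_uniq x0 c i : uniq c -> i < size c ->
  next c (nth x0 c i) = nth x0 c (if i.+1 == size c then 0 else i.+1).
Proof.
move=> uc ic; rewrite next_nth mem_nth //; case: c uc ic => // y c uc ic.
rewrite index_uniq //=; case: eqP => [[->]|ne]; first by rewrite nth_default.
by apply: set_nth_default; move: ic ne => /=; lia.
Qed.

(** Adding to an induced path a vertex adjacent to exactly its two ends closes
    it to an induced cycle. *)
Lemma closed_path_not_induced x0 y p : induced_path x0 p -> y \notin p ->
  1 < size p ->
  ~ (forall j, j < size p -> e y (nth x0 p j) = (j == 0) || (j.+1 == size p)).
Proof.
move=> [up ep] yp sp ey; apply: (tree_e (c := y :: p)).
have uc : uniq (y :: p) by rewrite /= yp.
split=> //; move=> _ _ /(nthP x0)[i ic <-] /(nthP x0)[j jc <-].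
have step a : a < size (y :: p) ->
    (if a.+1 == size (y :: p) then 0 else a.+1) < size (y :: p).
  by case: eqP => //=; lia.
rewrite !next_nth_uniq // !nth_uniq // ?step //.
case: i ic => [|i] /= ic; case: j jc => [|j] /= jc.
- by rewrite e_irr; case: ifP; lia.
- by rewrite ey //; do 2!case: ifP; lia.
- by rewrite e_sym ey //; do 2!case: ifP; lia.
- by rewrite ep //; do 2!case: ifP; lia.
Qed.

Lemma induced_path_take x0 p i : induced_path x0 p -> induced_path x0 (take i p).
Proof.
move=> [up ep]; split=> [|a b]; first exact: take_uniq.
rewrite !size_take_min !leq_min => /andP[ai ap] /andP[bi bp].
by rewrite !nth_take // ep.
Qed.

Lemma induced_path_cons x0 y p : induced_path x0 p -> y \notin p ->
    (forall j, j < size p -> e y (nth x0 p j) = (j == 0)) ->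
  induced_path x0 (y :: p).
Proof.
move=> [up ep] yp ey; split=> [|[|i] [|j] /= ip jp]; first by rewrite /= yp.
- by rewrite e_irr.
- by rewrite ey.
- by rewrite e_sym ey // orbF.
- by rewrite ep // !eqSS.
Qed.

(** Otherwise induced paths in [A] could be prolonged for ever.  The first
    vertex has in [A] a neighbour [y] other than the second one; if [y] were
    adjacent to a later vertex, the first such vertex would close an induced
    cycle through [y], and if not, [y] prolongs the path. *)
Lemma forest_leaf A : A != set0 ->
  exists2 v, v \in A & #|A :&: neighbours e v| <= 1.
Proof.
move=> /set0Pn[x0 x0A]; apply: contrapT => noleaf.
have deg2 v : v \in A -> 1 < #|A :&: neighbours e v|.
  by move=> vA; rewrite ltnNge; apply/negP => leaf; apply: noleaf; exists v.
have grow l : exists p, [/\ induced_path x0 p, {subset p <= A} & size p = l.+1].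
  elim: l => [|l [p [ip pA sp]]].
    exists [:: x0]; split=> //; last by move=> v; rewrite inE => /eqP->.
    by split=> // -[|i] [|j] //= _ _; rewrite e_irr.
  have [up ep] := ip; pose h := nth x0 p 0; pose h1 := nth x0 p 1.
  have hA : h \in A by apply/pA/mem_nth; rewrite sp.
  have [y yA yh1] : exists2 y, y \in A :&: neighbours e h & y != h1.
    have : 0 < #|(A :&: neighbours e h) :\ h1|.
      by have := deg2 h hA; rewrite (cardsD1 h1); case: (_ \in _); lia.
    by rewrite card_gt0 => /set0Pn[y]; rewrite in_setD1 => /andP[yh yA]; exists y.
  move: yA; rewrite !inE => /andP[yA ehy].
  have yp : y \notin p.
    apply/negP => /(nthP x0)[i ip' yi]; move: ehy yh1; rewrite -yi ep //= ?sp //.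
    by move=> /eqP->; rewrite eqxx.
  exists (y :: p); split; last by rewrite /= sp.
  - apply: induced_path_cons => // j jp.
    case: j jp => [|j] jp; first by rewrite e_sym.
    (* The induced cycle is [y] followed by [p] up to the first neighbour of [y]
       after the head; [i] is the position of that neighbour in the tail. *)
    apply/negP => yj; pose i := find (e y) (behead p).
    have sb : size (behead p) = l by rewrite size_behead sp.
    have nb a : nth x0 (behead p) a = nth x0 p a.+1 by rewrite nth_behead.
    have has_i : has (e y) (behead p).
      by apply/(has_nthP x0); exists j; rewrite ?nb // sb; lia.
    have il : i < l by rewrite -sb -has_find.
    have st : size (take i.+2 p) = i.+2 by rewrite size_takel // sp; lia.
    apply: (closed_path_not_induced (induced_path_take i.+2 ip) (y := y)); rewrite ?st //.
      by apply: contra yp; apply: mem_take.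
    move=> a ai; rewrite nth_take //; case: a ai => [|a] ai; first by rewrite e_sym.
    rewrite -nb !eqSS /=; case: eqP => [->|ai']; first exact: nth_find.
    by apply: before_find; rewrite -/i; lia.
  - by move=> v; rewrite inE => /orP[/eqP->|/pA].
have [p [[up _] _ sp]] := grow n.
by have := max_card (mem p); rewrite (card_uniqP up) sp card_ord ltnn.
Qed.

End Forests.

(** * Balanced families of index sets on a forest *)

Section LeastSubset.
Import boot.fintype boot.finset.
Lemma least_subset (T : finType) (B : {set T}) (f : T -> nat) o : o <= #|B| ->
  exists O : {set T}, [/\ O \subset B, #|O| = o &
    forall i j, i \in O -> j \in B :\: O -> f i <= f j].
Proof.
elim: o => [_|o IHo oB].
  by exists set0; rewrite sub0set cards0; split=> // i j; rewrite inE.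
have [O [OB cO fO]] := IHo (ltnW oB).
have : B :\: O != set0.
  by rewrite -card_gt0; have := cardsID O B; rewrite (setIidPr OB); lia.
case/set0Pn => j0 j0B; have [j jB jmin] := @arg_minnP _ j0 (fun i => i \in B :\: O) f j0B.
have := jB; rewrite !inE => /andP[jO jB'].
exists (j |: O); split; first by rewrite subUset sub1set jB'.
  by rewrite cardsU1 jO cO.
move=> a b; rewrite !inE negb_or -andbA => aO /and3P[bj bO bB].
have b_in : b \in B :\: O by rewrite inE bO.
by case/orP: aO => [/eqP->|aO]; [apply: jmin|apply: fO].
Qed.

End LeastSubset.

Section Colouring.
Import boot.fintype boot.finset.
Local Set Implicit Arguments.
Local Unset Strict Implicit.
Variables (n : nat) (e : rel 'I_n) (s : nat) (mu : 'I_n -> nat).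
Hypotheses (graph_e : is_simple_graph e) (tree_e : is_tree e).
Hypothesis mu_s : forall v, mu v <= s.
Implicit Types (A : {set 'I_n}) (u v x : 'I_n) (M : 'I_n -> {set 'I_s}) (j : 'I_s).

Let e_sym : ssrbool.symmetric e := graph_e.1.
Let e_irr : irreflexive e := graph_e.2.

Definition load A M v j : nat :=
  \sum_(u in A :&: neighbours e v) (j \in M u).

(** Here [mu v] stands for the number of indices that [v] has to receive; any
    two sets of [mu u] and [mu v] indices among [s] share at least
    [mu u + mu v - s] of them, so adjacent vertices share as few as possible.
    The balance of the loads lets a bound on their average bound each of
    them. *)
Definition balanced_family A M : Prop :=
  [/\ forall v, v \in A -> #|M v| = mu v,
      forall u v, u \in A -> v \in A -> e u v -> #|M u :&: M v| = mu u + mu v - s &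
      forall v, v \in A -> forall i j, i \in M v -> j \in M v ->
        load A M v i <= (load A M v j).+1].

(** The loads of two vertices only can change: that of the one earlier
    neighbour of [v], which the hypothesis controls, and that of [v], which is
    at most one since a single vertex contributes to it. *)
Lemma balanced_family_extend A M v (B : {set 'I_s}) :
    balanced_family A M -> v \notin A -> #|A :&: neighbours e v| <= 1 ->
    #|B| = mu v ->
    (forall x, x \in A -> e v x -> #|B :&: M x| = mu v + mu x - s /\
       forall i j, i \in M x -> j \in M x ->
         load A M x i + (i \in B) <= (load A M x j + (j \in B)).+1) ->
  balanced_family (v |: A) (fun u => if u == v then B else M u).
Proof.
move=> [cM oM lM] vA leaf cB HB; set M' := fun u => _.
have M'v : M' v = B by rewrite /M' eqxx.
have M'A u : u \in A -> M' u = M u.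
  by move=> uA; rewrite /M'; case: eqP => // uv; rewrite -uv uA in vA.
have load_adj x j : x \in A -> e v x ->
    load (v |: A) M' x j = load A M x j + (j \in B).
  move=> xA vx; rewrite /load.
  have -> : (v |: A) :&: neighbours e x = v |: (A :&: neighbours e x).
    by rewrite setIUl (setIidPl _) // sub1set inE e_sym.
  rewrite big_setU1 /= ?inE ?(negPf vA) // M'v addnC; congr (_ + _).
  by apply: eq_bigr => u; rewrite inE => /andP[/M'A-> _].
have load_nadj x j : x \in A -> ~~ e v x -> load (v |: A) M' x j = load A M x j.
  move=> xA vx; rewrite /load.
  have -> : (v |: A) :&: neighbours e x = A :&: neighbours e x.
    apply/setP => u; rewrite !inE; case: eqVneq => //= ->.
    by rewrite e_sym (negPf vx) andbF.
  by apply: eq_bigr => u; rewrite inE => /andP[/M'A-> _].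
have load_v j : load (v |: A) M' v j <= 1.
  rewrite /load; have -> : (v |: A) :&: neighbours e v = A :&: neighbours e v.
    by apply/setP => u; rewrite !inE; case: eqVneq => //= ->; rewrite e_irr andbF.
  apply: leq_trans leaf; rewrite -sum1_card; apply: leq_sum => u _; exact: leq_b1.
split=> [u|u w|u].
- by rewrite in_setU1 => /orP[/eqP->|uA]; rewrite ?M'v // M'A ?cM.
- rewrite !in_setU1 => /orP[/eqP->|uA] /orP[/eqP->|wA].
  + by rewrite e_irr.
  + by rewrite M'v M'A // => /(HB _ wA)[].
  + by rewrite e_sym M'v M'A // setIC addnC => /(HB _ uA)[].
  + by rewrite !M'A //; apply: oM.
- rewrite in_setU1 => /orP[/eqP->|uA] i j.
    by move=> _ _; rewrite (leq_trans (load_v i)).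
  rewrite M'A // => iM jM; have [vu|vu] := boolP (e v u).
    by rewrite !load_adj //; apply: (HB u uA vu).2.
  by rewrite !load_nadj //; apply: lM.
Qed.

(** The last vertex [v] added has at most one neighbour [x] before it.  The set
    of [v] is made of the least loaded indices of [M x], as many as it must
    share with [M x], and of indices outside [M x]. *)
Lemma balanced_family_exists A : exists M, balanced_family A M.
Proof.
have [N] := ubnP #|A|; elim: N A => // N IHN A cA.
have [->|A0] := eqVneq A set0.
  by exists (fun=> set0); split=> [v|u v|v]; rewrite inE.
have [v vA leaf] := forest_leaf graph_e tree_e A0.
have cD := cardsD1 v A; rewrite vA in cD.
have [|M HM] := IHN (A :\ v); first by lia.
have vD : v \notin A :\ v by rewrite !inE eqxx.
have ND : (A :\ v) :&: neighbours e v = A :&: neighbours e v.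
  by apply/setP => u; rewrite !inE; case: eqVneq => //= ->; rewrite e_irr andbF.
rewrite -(setD1K vA); rewrite -ND in leaf.
suff [B cB HB] : exists2 B : {set 'I_s}, #|B| = mu v &
    forall x, x \in A :\ v -> e v x -> #|B :&: M x| = mu v + mu x - s /\
       forall i j, i \in M x -> j \in M x ->
         load (A :\ v) M x i + (i \in B) <= (load (A :\ v) M x j + (j \in B)).+1.
  by eexists; apply: (balanced_family_extend HM vD leaf cB HB).
have [N0|/set0Pn[x]] := eqVneq ((A :\ v) :&: neighbours e v) set0.
  have [|B [_ cB _]] := @least_subset _ [set: 'I_s] (fun=> 0) (mu v).
    by rewrite cardsT card_ord.
  exists B => // x xA vx; have : x \in (A :\ v) :&: neighbours e v.
    by rewrite inE xA inE.
  by rewrite N0 inE.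
rewrite inE => /andP[xA]; rewrite inE => vx.
have [cM _ lM] := HM; have cx := cM x xA.
(* [O] is the part of the new set inside [M x], and [W] the part outside. *)
have [|O [OM cO fO]] := @least_subset _ (M x) (load (A :\ v) M x) (mu v + mu x - s).
  by rewrite cx; have := mu_s v; lia.
have [|W [WM cW _]] := @least_subset _ (~: M x) (fun=> 0) (mu v - #|O|).
  by have := cardsC (M x); rewrite card_ord; have := mu_s v; have := mu_s x; lia.
have dOW : [disjoint O & W].
  by rewrite disjoint_sym disjoints_subset (subset_trans WM) // setCS.
have OWM : (O :|: W) :&: M x = O.
  rewrite setIUl (setIidPl OM).
  have /eqP-> : W :&: M x == set0 by rewrite setI_eq0 disjoints_subset.
  by rewrite setU0.
have OWin i : i \in M x -> (i \in O :|: W) = (i \in O).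
  by move=> iM; rewrite -{2}OWM [RHS]inE iM andbT.
exists (O :|: W).
  by rewrite cardsU (disjoint_setI0 dOW) cards0 cW; have := mu_s x; lia.
move=> y yA vy; have -> : y = x.
  by apply: (card_le1_eqP leaf); rewrite inE ?xA ?yA inE.
rewrite OWM; split=> // i j iM jM; rewrite !OWin //.
have lij := lM x xA i j iM jM.
have [iO|iO] := boolP (i \in O); have [jO|jO] := boolP (j \in O);
  rewrite ?addn0 ?addn1.
- by rewrite ltnS.
- by rewrite ltnS; apply: fO => //; rewrite inE jO jM.
- exact: leqW.
- exact: lij.
Qed.

(** The loads at [v] sum up to the sizes of the overlaps of [M v] with the sets
    of the neighbours.  If one load exceeded [q], all would be at least [q] by
    balance, and their sum would exceed [q * mu v]. *)
Lemma load_le M v q : balanced_family [set: 'I_n] M ->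
    \sum_(u in neighbours e v) (mu u + mu v - s) <= q * mu v ->
  forall j, j \in M v -> load [set: 'I_n] M v j <= q.
Proof.
move=> [cM oM lM] sum_le j jM; rewrite leqNgt; apply/negP => q_lt.
have : \sum_(i in M v) load [set: 'I_n] M v i <= q * mu v.
  apply: leq_trans sum_le; rewrite /load exchange_big /= setTI.
  apply: leq_sum => u; rewrite inE => vu.
  rewrite -oM ?inE // 1?e_sym // -sum1_card big_mkcond /= [leqRHS]big_mkcond.
  by apply: leq_sum => i _; rewrite inE; case: (i \in M u); case: (i \in M v).
rewrite (bigD1 j) //= leqNgt => /negP; apply.
have : \sum_(i in M v | i != j) q <= \sum_(i in M v | i != j) load [set: 'I_n] M v i.
  apply: leq_sum => i /andP[iM _].
  by rewrite -ltnS; apply: leq_trans q_lt _; apply: lM; rewrite ?inE.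
rewrite sum_nat_const (_ : #|_| = (mu v).-1); last first.
  rewrite -(cM v) ?inE // [in RHS](cardD1 j) jM /=.
  by apply: eq_card => i; rewrite !inE andbC.
have : 0 < mu v by rewrite -(cM v) ?inE // card_gt0; apply/set0Pn; exists j.
move: q_lt; case: (mu v) => // m q_lt _ rest_le; rewrite mulnS mulnC -addSn.
exact: leq_add q_lt rest_le.
Qed.

End Colouring.

(** * Monomial ideals and their associated primes *)

Local Open Scope classical_set_scope.

Section MonomialIdeals.
Set Implicit Arguments.
Unset Strict Implicit.
Import GRing.Theory.
Local Open Scope ring_scope.
Variables (n : nat) (k : fieldType).
Implicit Types (U V : set 'X_{1..n}) (f g T : {mpoly k[n]}) (m a b : 'X_{1..n}).
Implicit Types (I P : set {mpoly k[n]}) (F : {set 'I_n}).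

Definition upclosed U : Prop := forall a b, U a -> U (a + b)%MM.

(** All ideals of interest are encoded by their sets of exponents; this is an
    ideal as soon as [U] is [upclosed]. *)
Definition monomial_ideal U : set {mpoly k[n]} :=
  [set f | forall m, m \in msupp f -> U m].

Definition hits F : set 'X_{1..n} := [set m | exists2 i, i \in F & (0 < m i)%N].

Definition add_set U V : set 'X_{1..n} := [set (a + b)%MM | a in U & b in V].

Lemma upclosed_lem U a b : upclosed U -> U a -> (a <= b)%MM -> U b.
Proof. by move=> upU Ua /submK <-; rewrite addmC; apply: upU. Qed.

Lemma upclosed_hits F : upclosed (hits F).
Proof. by move=> a b [i iF ai]; exists i => //; rewrite mnmDE addn_gt0 ai. Qed.

Lemma upclosed_add_set U V : upclosed V -> upclosed (add_set U V).
Proof.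
move=> upV _ c [a Ua [b Vb <-]]; rewrite -addmA.
by exists a => //; exists (b + c)%MM => //; apply: upV.
Qed.

Lemma monomial_ideal_is_ideal U : upclosed U -> is_ideal (monomial_ideal U).
Proof.
move=> upU; split=> [m|f g If Ig m|f g Ig m].
- by rewrite msupp0.
- by move/msuppD_le; rewrite mem_cat => /orP[/If|/Ig].
- case/msuppM_le/allpairsP => -[a b] /= [_ /Ig Ub ->].
  by rewrite addmC; apply: upU.
Qed.

Lemma monomial_idealX U m : monomial_ideal U 'X_[m] <-> U m.
Proof.
split=> [|Um m']; first by apply; rewrite msuppX inE.
by rewrite msuppX inE => /eqP->.
Qed.

Lemma ideal_mpoly I f : is_ideal I ->
  (forall m, m \in msupp f -> I 'X_[m]) -> I f.
Proof.
move=> [I0 ID IM] If; rewrite [f]mpolyE big_seq.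
by apply: (big_ind I) => // m /If; rewrite -mul_mpolyC; apply: IM.
Qed.

Lemma ideal_sub I f g : is_ideal I -> I f -> I g -> I (f - g).
Proof. by case=> _ ID IM If Ig; apply: ID => //; rewrite -mulN1r; apply: IM. Qed.

Definition restrict U f : {mpoly k[n]} :=
  \sum_(m <- msupp f | `[< U m >]) f@_m *: 'X_[m].

Lemma mcoeff_restrict U f m :
  (restrict U f)@_m = if `[< U m >] then f@_m else 0.
Proof.
rewrite raddf_sum /=.
under eq_bigr do rewrite mcoeffZ mcoeffX.
have off a : a != m -> f@_a * (a == m)%:R = 0 by move=> /negPf->; rewrite mulr0.
case: (boolP (m \in msupp f)) => /= mf; last first.
  rewrite (memN_msupp_eq0 mf) if_same big_seq_cond big1 // => a /andP[af _].
  by apply: off; apply: contraNneq mf => <-.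
case: asboolP => Um /=.
  rewrite (big_rem m mf) /= asboolT // eqxx mulr1 big_seq_cond big1 ?addr0 //.
  move=> a; rewrite mem_rem_uniq ?msupp_uniq // inE => /andP[/andP[/= am _] _].
  exact: off.
by rewrite big1 // => a /asboolP Ua; apply: off; apply/eqP => am; rewrite am in Ua.
Qed.

Lemma msupp_restrict U f m :
  (m \in msupp (restrict U f)) = (m \in msupp f) && `[< U m >].
Proof.
by rewrite !mcoeff_msupp mcoeff_restrict; case: ifP; rewrite ?eqxx ?andbT ?andbF.
Qed.

Lemma restrict_sub I U f : is_ideal I -> (forall m, ~ U m -> I 'X_[m]) ->
  I (f - restrict U f).
Proof.
move=> idI IU; apply: ideal_mpoly => // m.
rewrite mcoeff_msupp mcoeffB mcoeff_restrict.
by case: asboolP => [_|/IU//]; rewrite subrr eqxx.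
Qed.

(** Modulo the ideal, two polynomials outside of it may be replaced by nonzero
    polynomials without exponents in [V]; the leading exponent of their
    product is a sum of two exponents outside [V]. *)
Lemma monomial_ideal_prime V : upclosed V -> ~ V 0%MM ->
    (forall a b, V (a + b)%MM -> V a \/ V b) ->
  is_prime_ideal (monomial_ideal V).
Proof.
move=> upV V0 VD; have idV := monomial_ideal_is_ideal upV.
have [_ idD idM] := idV.
split=> // [VT|f g Vfg].
  by apply: V0; apply/monomial_idealX; rewrite VT.
pose r h := restrict (~` V) h.
have rV h : monomial_ideal V (h - r h).
  by apply: (restrict_sub _ idV) => // m /contrapT Vm; apply/monomial_idealX.
have r0 h : r h = 0 -> monomial_ideal V h.
  by move=> rh; have := rV h; rewrite rh subr0.
have Vr h : r h != 0 -> ~ V (mlead (r h)).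
  by move/mlead_supp; rewrite msupp_restrict => /andP[_ /asboolP].
have [/r0|rf] := eqVneq (r f) 0; first by left.
have [/r0|rg] := eqVneq (r g) 0; first by right.
have : monomial_ideal V (r f * r g).
  have -> : r f * r g = f * g - (f * (g - r g) + r g * (f - r f)).
    by ring.
  by apply: (ideal_sub idV) => //; apply: idD; apply: idM.
move/(_ (mlead (r f * r g))); rewrite mlead_supp ?mulf_neq0 // mleadM //.
by move/(_ isT)/VD => -[/(Vr _ rf)|/(Vr _ rg)].
Qed.

Lemma ideal_colon1 I T : is_ideal I ->
  ideal_colon I (ideal_gen [set T]) = [set f | I (f * T)].
Proof.
move=> [I0 ID IM]; apply/seteqP; split=> f /= If.
  by apply: If => J [_]; apply.
move=> g gT; apply: (gT [set h | I (f * h)]); split; last by move=> _ ->.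
split=> /= [|g1 g2 Ig1 Ig2|g1 g2 Ig2]; rewrite ?mulr0 ?mulrDr //; first exact: ID.
by rewrite mulrCA; apply: IM.
Qed.

(** Associated primes of monomial ideals are monomial.  Let [h] be the part of
    [f] whose monomials are not in [P], with leading exponent [l], and suppose
    [h <> 0].  As [h * T] lies in the ideal, so does the monomial of exponent
    [l + mlead T].  Hence removing the leading term of [T] and multiplying by
    ['X_[l]], which is not in [P], gives a polynomial with the same colon ideal
    and fewer terms than [T]. *)
Lemma ass_monomial_terms U P T f m : upclosed U -> is_prime_ideal P ->
  P = [set f | monomial_ideal U (f * T)] -> P f -> m \in msupp f -> P 'X_[m].
Proof.
move=> upU [idP _ prP] PT Pf mf.
elim: {T}(size _) {-2}T (leqnn (size (msupp T))) PT => [|N IHN] T sT PT.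
  move: sT; rewrite leqn0 size_eq0 msupp_eq0 => /eqP T0.
  by rewrite PT T0 /= mulr0 => a; rewrite msupp0.
have [T0|T0] := eqVneq T 0.
  by rewrite PT T0 /= mulr0 => a; rewrite msupp0.
pose h := restrict [set a | ~ P 'X_[a]] f.
have [h0|h0] := eqVneq h 0.
  apply: contrapT => Pm; have : m \in msupp h.
    by rewrite msupp_restrict mf asboolT.
  by rewrite h0 msupp0.
have Ph : P h.
  rewrite -[h](subKr f); apply: (ideal_sub idP) => //.
  by apply: (restrict_sub _ idP) => // a /contrapT.
have idU := monomial_ideal_is_ideal upU; have [_ idD idM] := idU.
set l := mlead h.
have Pl : ~ P 'X_[l].
  by have := mlead_supp h0; rewrite msupp_restrict => /andP[_ /asboolP].
have Ul : U (l + mlead T)%MM.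
  have : monomial_ideal U (h * T) by rewrite PT in Ph.
  by apply; rewrite -mleadM // mlead_supp // mulf_neq0.
set R := T - T@_(mlead T) *: 'X_[mlead T].
apply: (IHN (R * 'X_[l])).
  rewrite (perm_size (msuppMX _ _)) size_map (perm_size (msupp_rem _ _)).
  by rewrite size_rem ?mlead_supp // -ltnS prednK //
     lt0n size_eq0 msupp_eq0.
have Q g : monomial_ideal U (g * (R * 'X_[l])) <-> monomial_ideal U (g * 'X_[l] * T).
  have -> : g * 'X_[l] * T =
      g * (R * 'X_[l]) + (g * (T@_(mlead T))%:MP) * 'X_[l + mlead T].
    rewrite mpolyXD /R mulrBl mulrBr -mul_mpolyC -!mulrA.
    rewrite ['X_[l] * T]mulrC ['X_[mlead T] * _]mulrC !mulrA addrNK //.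
  split=> H; first by apply: idD => //; apply: idM; apply/monomial_idealX.
  rewrite -[X in monomial_ideal U X](addrK ((g * (T@_(mlead T))%:MP) * 'X_[l + mlead T])).
  by apply: (ideal_sub idU) => //; apply: idM; apply/monomial_idealX.
have PTE g : P g <-> monomial_ideal U (g * T) by rewrite PT.
apply/seteqP; split=> g /=; rewrite Q -PTE.
  by move=> Pg; case: idP => _ _ iM; rewrite mulrC; apply: iM.
by case/prP.
Qed.
Lemma hitsD F a b : hits F (a + b)%MM -> hits F a \/ hits F b.
Proof.
move=> [i iF]; rewrite mnmDE addn_gt0 => /orP[ai|bi].
  by left; exists i.
by right; exists i.
Qed.

Lemma hits_prime F : is_prime_ideal (monomial_ideal (hits F)).
Proof.
apply: monomial_ideal_prime (@hitsD F); first exact: upclosed_hits.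
by case=> i _; rewrite mnm0E.
Qed.

Lemma prime_monomial_hits P m : is_prime_ideal P ->
  P 'X_[m] -> hits [set i | `[< P 'X_i >]] m.
Proof.
move=> [idP PT prP] Pm; have P1 : ~ P 1.
  move=> P1; apply: PT; apply/seteqP; split=> // f _.
  by case: idP => _ _ iM; rewrite -[f]mulr1; apply: iM.
apply: contrapT => Fm; apply: (_ : ~ P 'X_[m]) => //.
rewrite mpolyXE_id; apply: (big_ind (fun f => ~ P f)) => // [f g Pf Pg /prP[]//|i _].
have [->|mi] := posnP (m i); first by rewrite expr0.
have Pi : ~ P 'X_i by move=> Pi; apply: Fm; exists i; rewrite // inE; apply/asboolP.
by elim: (m i) => [|j IHj]; rewrite ?expr0 // exprS => /prP[].
Qed.

Lemma prime_ideal_hits P : is_prime_ideal P ->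
    (forall f m, P f -> m \in msupp f -> P 'X_[m]) ->
  P = monomial_ideal (hits [set i | `[< P 'X_i >]]).
Proof.
move=> prP mP; apply/seteqP; split=> f Pf.
  by move=> m /(mP _ _ Pf); apply: prime_monomial_hits.
have [idP _ _] := prP; apply: (ideal_mpoly idP) => m /Pf[i].
rewrite inE => /asboolP Pi mi; have im : (U_(i) <= m)%MM.
  by apply/mnm_lepP => j; rewrite mnm1E; case: eqVneq => // <-.
by rewrite -(submK im) mpolyXD; case: idP => _ _; apply.
Qed.

(** A prime that is the colon ideal by [T] contains the intersection of the
    colon ideals by the monomials of [T], hence one of these, and it is
    contained in all of them. *)
Lemma ass_monomialP U P : upclosed U ->
  Ass (monomial_ideal U) P <->
  exists F a, P = monomial_ideal (hits F) /\ forall m, U (m + a)%MM <-> hits F m.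
Proof.
move=> upU; have idU := monomial_ideal_is_ideal upU; split; last first.
  move=> [F [a [-> Ua]]]; split; first exact: hits_prime.
  exists 'X_[a]; rewrite ideal_colon1 //; apply/seteqP; split=> f /= Hf m.
    rewrite (perm_mem (msuppMX _ _)) => /mapP[b bf ->].
    by rewrite addmC Ua; apply: Hf.
  move=> mf; apply/Ua; apply: Hf.
  by rewrite (perm_mem (msuppMX _ _)) addmC; apply: map_f.
move=> [prP [T]]; rewrite ideal_colon1 // => PT.
have mP f m := @ass_monomial_terms U P T f m upU prP PT.
have PF := prime_ideal_hits prP mP.
set F := [set i | _]%SET in PF.
have PX m : monomial_ideal U ('X_[m] * T) <-> hits F m.
  by rewrite -(@monomial_idealX (hits F)) -PF PT.
(* Otherwise each monomial of [T] is sent into the ideal by a monomial outside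
   [P], and the product of these sends [T] into the ideal. *)
have [a aT aF] : exists2 a, a \in msupp T & forall m, U (m + a)%MM -> hits F m.
  apply: contrapT => noa.
  have avoid b : b \in msupp T -> exists2 m, ~ hits F m & U (m + b)%MM.
    move=> bT; apply: contrapT => nom; apply: noa; exists b => // m Um.
    by apply: contrapT => Fm; apply: nom; exists m.
  have [M FM UM] : exists2 M, ~ hits F M & forall b, b \in msupp T -> U (M + b)%MM.
    elim: (msupp T) avoid => [_|b s IHs avoid].
      by exists 0%MM => // -[i _]; rewrite mnm0E.
    have [|M FM UM] := IHs; first by move=> c cs; apply: avoid; rewrite inE cs orbT.
    have [|m Fm Um] := avoid b; first by rewrite mem_head.
    exists (M + m)%MM => [/hitsD[]//|c]; rewrite inE => /orP[/eqP->|/UM UMc].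
      by rewrite -addmA addmC; apply: upU.
    by rewrite -addmA [(m + c)%MM]addmC addmA; apply: upU.
  apply/FM/PX => m; rewrite mulrC (perm_mem (msuppMX _ _)) => /mapP[b bT ->].
  exact: UM.
exists F, a; split=> // m; split; first exact: aF.
move/PX; apply; rewrite mulrC (perm_mem (msuppMX _ _)); apply: map_f.
exact: aT.
Qed.

Lemma ideal_gen_is_ideal I : is_ideal (ideal_gen I).
Proof.
split=> [J [[J0 _ _] _] //|f g If Ig J JI|f g Ig J JI]; have [[_ JD JM] _] := JI.
- by apply: JD; [apply: If|apply: Ig].
- by apply: JM; apply: Ig.
Qed.

Lemma ideal_mul_monomial U V : upclosed U -> upclosed V ->
  ideal_mul (monomial_ideal U) (monomial_ideal V) = monomial_ideal (add_set U V).
Proof.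
move=> upU upV; apply/seteqP; split=> f Hf.
  apply: Hf; split.
    by apply: monomial_ideal_is_ideal; apply: upclosed_add_set.
  move=> _ [g Ug [h Vh <-]] m /msuppM_le/allpairsP[[a b] /= [/Ug Ua /Vh Vb ->]].
  by exists a => //; exists b.
apply: ideal_mpoly; first exact: ideal_gen_is_ideal.
move=> m /Hf[a Ua [b Vb <-]] J [_]; apply; rewrite mpolyXD.
exists 'X_[a]; first exact/monomial_idealX.
by exists 'X_[b]; first exact/monomial_idealX.
Qed.

Definition pow_set U s : set 'X_{1..n} := iter s (add_set U) setT.

Lemma upclosed_pow_set U s : upclosed U -> upclosed (pow_set U s).
Proof. by move=> upU; case: s => // s; elim: s => [|s IHs]; apply: upclosed_add_set. Qed.

Lemma ideal_pow_monomial U s : upclosed U ->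
  ideal_pow (monomial_ideal U) s = monomial_ideal (pow_set U s).
Proof.
move=> upU; elim: s => [|s IHs]; first by apply/seteqP; split=> f.
rewrite /ideal_pow /= -/(ideal_pow _ s) IHs ideal_mul_monomial //.
exact: upclosed_pow_set.
Qed.

Lemma ideal_gen_vars F :
  ideal_gen [set ('X_i : {mpoly k[n]}) | i in [set i | i \in F]] =
  monomial_ideal (hits F).
Proof.
apply/seteqP; split=> f Hf.
  apply: Hf; split; first exact/monomial_ideal_is_ideal/upclosed_hits.
  move=> _ [i /= iF <-]; apply/monomial_idealX.
  by exists i; rewrite // mnm1E eqxx.
apply: ideal_mpoly; first exact: ideal_gen_is_ideal.
move=> m /Hf[i iF mi] J [[_ _ JM] FJ]; have im : (U_(i) <= m)%MM.
  by apply/mnm_lepP => j; rewrite mnm1E; case: eqVneq => // <-.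
by rewrite -(submK im) mpolyXD; apply/JM/FJ; exists i.
Qed.

Definition uncovered (e : rel 'I_n) m (x : 'I_n) : {set 'I_n} :=
  [set y in neighbours e x | m y == 0%N]%SET.

Definition cover_set (e : rel 'I_n) (t : nat) : set 'X_{1..n} :=
  [set m : 'X_{1..n} | forall x, m x = 0%N -> (#|uncovered e m x| < t)%N].

Lemma upclosed_cover_set (e : rel 'I_n) t : upclosed (cover_set e t).
Proof.
move=> a b Ca x; rewrite mnmDE => /eqP; rewrite addn_eq0 => /andP[/eqP/Ca lt_t _].
apply: leq_ltn_trans lt_t; apply/subset_leq_card/fintype.subsetP => y.
by rewrite !inE mnmDE addn_eq0 => /and3P[-> ->].
Qed.

(** A monomial avoids the prime generated by [x] and by [t] of its neighbours
    exactly if it involves neither [x] nor any of these neighbours. *)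
Lemma partial_cover_idealE (e : rel 'I_n) t :
  partial_cover_ideal k e t = monomial_ideal (cover_set e t).
Proof.
rewrite /partial_cover_ideal; apply/seteqP; split=> f /= Hf.
  move=> m mf x mx; rewrite ltnNge; apply/negP => /card_geqP[s [us ss sub]].
  have sS y : y \in [set y in s]%SET -> e x y && (m y == 0%N).
    by rewrite inE => /sub; rewrite !inE.
  have := Hf x I [set y in s]%SET; rewrite ideal_gen_vars.
  case/(_ _ m mf) => [|y].
    split; first by apply/fintype.subsetP => y /sS/andP[]; rewrite inE.
    by rewrite cardsE (card_uniqP us).
  by rewrite in_setU1 => /orP[/eqP->|/sS/andP[_ /eqP->]]; rewrite ?mx.
move=> x _ S [SN cS]; rewrite ideal_gen_vars => m /Hf Cm.
apply: contrapT => Fm; have m0 y : y \in x |: S -> m y = 0%N.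
  by move=> yF; apply/eqP; rewrite eqn0Ngt; apply/negP => my; apply: Fm; exists y.
have := Cm x (m0 x (setU11 _ _)); rewrite ltnNge -cS => /negP; apply.
apply/subset_leq_card/fintype.subsetP => y yS; rewrite inE (fintype.subsetP SN) //=.
by rewrite m0 // setU1r.
Qed.

End MonomialIdeals.

(** * Powers of the partial cover ideal of a forest *)

Section Powers.
Import boot.fintype boot.finset.
Local Set Implicit Arguments.
Local Unset Strict Implicit.
Variables (n : nat) (e : rel 'I_n) (t : nat).
Hypothesis t_gt0 : 0 < t.
Implicit Types (x i : 'I_n) (m a : 'X_{1..n}).

Definition star_cond s m x : Prop :=
  \sum_(i in neighbours e x) (s - m x - m i) <= (t - 1) * (s - m x).

Lemma sum_bool_card (I : finType) (N : {set I}) (b : pred I) :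
  \sum_(i in N) (b i : nat) = #|[set i in N | b i]|.
Proof.
rewrite -sum1_card [LHS]big_mkcond [RHS]big_mkcond; apply: eq_bigr => i _.
by rewrite inE; case: (i \in N); case: (b i).
Qed.

(** The sum is a convex function of [w] that vanishes at 0, so its
    quotient by [w] is nondecreasing. *)
Lemma star_sum_shrink (I : finType) (N : {set I}) (f : I -> nat) q w w0 :
  w <= w0 -> \sum_(i in N) (w0 - f i) <= q * w0 -> \sum_(i in N) (w - f i) <= q * w.
Proof.
case: w0 => [|w0]; first by rewrite leqn0 => /eqP->.
move=> w_le sum_w0; rewrite -(leq_pmul2l (ltn0Sn w0)).
have step : w0.+1 * (\sum_(i in N) (w - f i)) <= w * (\sum_(i in N) (w0.+1 - f i)).
  rewrite !big_distrr /=; apply: leq_sum => i _.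
  by have [|] := leqP (f i) w; nia.
by apply: leq_trans step _; nia.
Qed.

(** By induction on [s].  If the added cover contains [x], then [s - m x] does
    not grow and [star_sum_shrink] applies; if not, it grows by at most one,
    and each of the at most [t-1] neighbours outside the cover adds at most
    one to the sum. *)
Lemma pow_set_star s m : pow_set (cover_set e t) s m -> forall x, star_cond s m x.
Proof.
elim: s m => [|s IHs] m.
  by move=> _ x; rewrite /star_cond big1 // => i _; rewrite sub0n.
case=> a Ca [b /IHs Sb <-] x; have {Sb} := Sb x; rewrite /star_cond.
under [X in _ -> X <= _]eq_bigr do rewrite !mnmDE; rewrite mnmDE => Sb.
have [ax|ax] := posnP (a x); last first.
  apply: (@star_sum_shrink _ _ _ _ _ (s - b x)); first by lia.
  apply: leq_trans Sb; apply: leq_sum => i _; lia.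
have [bx|bx] := ltnP s (b x).
  by rewrite big1 // => i _; lia.
have Cx := Ca x ax.
have : \sum_(i in neighbours e x) (a i == 0) <= t - 1.
  by rewrite sum_bool_card -/(uncovered e a x); lia.
move=> Sa; rewrite ax.
apply: (@leq_trans (\sum_(i in neighbours e x) (s - b x - b i + (a i == 0)))).
  by apply: leq_sum => i _; case: eqP => /= *; lia.
by rewrite big_split add0n subSn // mulnS addnC leq_add.
Qed.

Lemma pow_set_sum (U : classical_sets.set 'X_{1..n}) s (c : 'I_s -> 'X_{1..n}) :
  (forall j, U (c j)) -> pow_set U s (\sum_(j < s) c j)%MM.
Proof.
elim: s c => [//|s IHs] c Uc; rewrite big_ord_recl.
exists (c ord0) => //; exists (\sum_(j < s) c (lift ord0 j))%MM => //.
exact: IHs.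
Qed.

Hypotheses (graph_e : is_simple_graph e) (tree_e : is_tree e).

(** Cover number [j] consists of the vertices [v] with [j] not in [M v], for a
    balanced family [M] on the whole forest: if it misses [x], then the number
    of neighbours of [x] that it misses is the load of [x] at [j]. *)
Lemma star_pow_set s m : (forall x, star_cond s m x) -> pow_set (cover_set e t) s m.
Proof.
move=> Sm; pose mu v := s - m v.
have mu_s v : mu v <= s by apply: leq_subr.
have [M HM] := balanced_family_exists graph_e tree_e mu_s [set: 'I_n].
have [cM _ _] := HM.
pose c (j : 'I_s) := [multinom (j \notin M i : nat) | i < n].
apply: (@upclosed_lem _ _ (\sum_(j < s) c j)%MM).
- exact/upclosed_pow_set/upclosed_cover_set.
- apply: pow_set_sum => j x; rewrite mnmE => /eqP; rewrite eqb0 negbK => jM.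
  have : load e [set: 'I_n] M x j <= t - 1.
    apply: (load_le graph_e HM) jM; apply: leq_trans (Sm x).
    by apply: leq_sum => i _; rewrite /mu; lia.
  rewrite /load setTI sum_bool_card.
  rewrite (_ : [set _ in _ | _] = uncovered e (c j) x); first lia.
  by apply/setP => i; rewrite !inE mnmE eqb0 negbK.
- apply/mnm_lepP => i; rewrite mnm_sumE.
  under eq_bigr do rewrite mnmE.
  have -> : \sum_(j < s) (j \notin M i) = #|~: M i|.
    have := sum_bool_card [set: 'I_s] (fun j => j \notin M i).
    rewrite (eq_bigl xpredT) => [->|j]; last by rewrite inE.
    by apply: eq_card => j; rewrite !inE.
  by have := cardsC (M i); rewrite card_ord cM ?inE // /mu; lia.
Qed.

Lemma triangle_free x y z : e x y -> e x z -> ~~ e y z.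
Proof.
have [e_sym e_irr] := graph_e; move=> xy xz; apply/negP => yz.
have ne u v : e u v -> (u == v) = false.
  by move=> uv; apply/eqP => E; move: uv; rewrite E e_irr.
have ne' u v : e u v -> (v == u) = false by rewrite eq_sym; apply: ne.
apply: (tree_e (c := [:: x; y; z])); split=> //.
  by rewrite /= !inE !ne.
have adj := (xy, xz, yz, e_irr, e_sym y x, e_sym z x, e_sym z y).
have dst := (ne _ _ xy, ne _ _ xz, ne _ _ yz, ne' _ _ xy, ne' _ _ xz, ne' _ _ yz).
by move=> u v; rewrite !inE => /or3P[]/eqP-> /or3P[]/eqP->;
  rewrite /= !(eqxx, dst) !adj.
Qed.

(** The sets of variables that generate the associated primes of the [s]-th
    power. *)
Definition star_set s (F : {set 'I_n}) : Prop :=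
  exists x (S : {set 'I_n}), [/\ F = x |: S, S \subset neighbours e x,
    t <= #|S| & #|S| <= (t - 1) * s + 1].

(** Multiplying by large powers of the variables outside [F] leaves the
    monomial outside the power, so the star condition fails at some [x] for
    the resulting exponents [b].  Adding any variable of [F] repairs it; this
    forces [F] to lie in the closed neighbourhood of [x], makes the condition
    fail by exactly one, and makes each term of the sum for a neighbour in [F]
    positive.  Comparing the number of these terms with their sum, which is
    [(t-1) * (s - b x) + 1], and with the bound [s - b x] of each gives the
    two inequalities. *)
Lemma star_set_of_witness s a (F : {set 'I_n}) :
  (forall m, pow_set (cover_set e t) s (m + a)%MM <-> hits F m) -> star_set s F.
Proof.
move=> witness; pose off := [multinom (i \notin F) * s | i < n].
pose b := (off + a)%MM.
have b_off i : i \notin F -> s <= b i.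
  by move=> iF; rewrite mnmDE mnmE iF mul1n leq_addr.
have bump i : i \in F -> forall x, star_cond s (U_(i) + b)%MM x.
  move=> iF; apply: pow_set_star; rewrite addmA; apply/witness.
  by exists i; rewrite // mnmDE mnm1E eqxx.
have [x] : exists x, ~ star_cond s b x.
  apply: contrapT => nox; have : hits F off.
    by apply/witness/star_pow_set => x; apply: contrapT => Sx; apply: nox; exists x.
  by case=> i iF; rewrite mnmE iF.
clearbody b; rewrite /star_cond => /negP; rewrite -ltnNge; set w := s - b x => b_gt.
have xF : x \in F.
  apply: contraLR b_gt => /b_off; rewrite -subn_eq0 -/w => /eqP->.
  by rewrite big1 // => i _; rewrite sub0n.
have FN i : i \in F -> i != x -> i \in neighbours e x.
  move=> iF ix; apply: contraLR b_gt => iN; rewrite -leqNgt.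
  have := bump i iF x; rewrite /star_cond mnmDE mnm1E (negPf ix) add0n -/w.
  apply: leq_trans; apply: leq_sum => j jN.
  by rewrite mnmDE mnm1E; case: eqP iN => // ->; rewrite jN.
pose S := F :\ x; exists x, S.
have SN : S \subset neighbours e x.
  by apply/subsetP => i; rewrite !in_setD1 => /andP[ix /FN]; apply.
have sumS : \sum_(i in neighbours e x) (w - b i) = \sum_(i in S) (w - b i).
  rewrite (big_setID S) /= (setIidPr SN) [X in _ + X]big1 ?addn0 // => i.
  rewrite !inE negb_and negbK => /andP[iS iN].
  case/orP: iS => [/eqP ix|/b_off]; last by rewrite /w; lia.
  by case: graph_e => _ e_irr; rewrite ix e_irr in iN.
have S_bump i : i \in S -> 0 < w - b i /\ \sum_(j in S) (w - b j) <= (t - 1) * w + 1.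
  move=> iS; have := iS; rewrite in_setD1 => /andP[ix iF].
  have := bump i iF x; rewrite /star_cond mnmDE mnm1E (negPf ix) add0n -/w.
  move: b_gt; rewrite sumS.
  rewrite [in X in X -> _](bigD1 i) //= [in X in _ -> X -> _](bigD1 i) ?(subsetP SN) //=.
  rewrite [in X in _ -> _ -> X](bigD1 i) //= mnmDE mnm1E eqxx.
  suff : \sum_(j in S | j != i) (w - b j) <=
      \sum_(j in neighbours e x | j != i) (w - (U_(i) + b)%MM j).
    rewrite add1n; move: (\sum_(j in S | _) _) (\sum_(j in neighbours e x | _) _).
    by move: ((t - 1) * w); clear; lia.
  rewrite big_mkcond [leqRHS]big_mkcond; apply: leq_sum => j _.
  have [jS|//] := boolP (j \in S); rewrite (subsetP SN j jS) /=.
  by case: eqVneq => // ji; rewrite mnmDE mnm1E eq_sym (negPf ji).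
have t_S : t <= #|S|.
  have : \sum_(i in S) (w - b i) <= #|S| * w.
    by rewrite -sum_nat_const; apply: leq_sum => i _; apply: leq_subr.
  move: b_gt; rewrite sumS => lt le; have := leq_trans lt le.
  by rewrite ltn_mul2r => /andP[_]; lia.
split=> //; first by rewrite setD1K.
have [i iS] : exists i, i \in S by apply/set0Pn; rewrite -card_gt0 (leq_trans t_gt0).
have : #|S| <= \sum_(j in S) (w - b j).
  by rewrite -sum1_card; apply: leq_sum => j /S_bump[].
move=> /leq_trans/(_ (S_bump i iS).2)/leq_trans; apply.
by rewrite leq_add2r leq_mul2l leq_subr orbT.
Qed.

Lemma bounded_parts (I : finType) (S : {set I}) s N : #|S| <= N -> N <= #|S| * s ->
  exists2 c : I -> nat, (forall i : I, i \in S -> 0 < c i <= s) & \sum_(i in S) c i = N.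
Proof.
elim: N => [|N IHN] SN Ns.
  exists (fun=> 0); last by rewrite big1.
  by move: SN; rewrite leqn0 cards_eq0 => /eqP-> i; rewrite inE.
move: SN; rewrite leq_eqVlt => /orP[/eqP SN|]; last first.
  rewrite ltnS => /IHN[|c cs sumc]; first exact: ltnW.
  have [i iS ci] : exists2 i, i \in S & c i < s.
    apply: contrapT => noi; have : #|S| * s <= \sum_(i in S) c i.
      rewrite -sum_nat_const; apply: leq_sum => i iS; rewrite leqNgt.
      by apply/negP => ci; apply: noi; exists i.
    by rewrite sumc leqNgt Ns.
  exists (fun j => (j == i) + c j) => [j jS|].
    by case: eqVneq => [->|_]; rewrite ?add1n ?ci ?add0n //; apply: cs.
  rewrite big_split sumc (bigD1 i iS) /= eqxx big1 // => j /andP[_ /negPf->] //.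
exists (fun=> 1); last by rewrite sum1_card.
by move=> i iS; rewrite /= lt0n; apply/eqP => s0; rewrite -SN s0 muln0 in Ns; lia.
Qed.

(** The witness is chosen so that the star condition at [x] fails by exactly
    one: [x] has exponent 0 and the sum [(t-1) * s + 1] is split into terms
    [1 <= c i <= s] for [i] in [S].  Adding a variable of [S] lowers one term,
    and adding [x] lowers all [#|S| >= t] terms by one but the bound by [t-1]
    only.  The variables outside [F] get exponent [s], which makes their star
    conditions trivial.  The condition at [y] in [S] concerns only the pair
    [x], [y] because the elements of [S] are pairwise nonadjacent. *)
Lemma witness_of_star_set s (F : {set 'I_n}) : 0 < s -> star_set s F ->
  exists a, forall m, pow_set (cover_set e t) s (m + a)%MM <-> hits F m.
Proof.
move=> s_gt0 [x [S [-> SN t_S S_ts]]].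
have [e_sym e_irr] := graph_e.
have xS : x \notin S by apply/negP => /(subsetP SN); rewrite inE e_irr.
have eS i : i \in S -> e x i by move/(subsetP SN); rewrite inE.
have [||c cs sumc] := @bounded_parts _ S s ((t - 1) * s + 1) => //.
  by move: t_S t_gt0 s_gt0; nia.
pose a := [multinom if i == x then 0 else if i \in S then s - c i else s | i < n].
have ax : a x = 0 by rewrite mnmE eqxx.
have aS i : i \in S -> a i = s - c i.
  by move=> iS; rewrite mnmE iS; case: eqP iS => // ->; rewrite (negPf xS).
have aF i : i \notin x |: S -> a i = s.
  by rewrite !inE mnmE => /norP[/negPf-> /negPf->].
exists a => m; split.
  move=> /pow_set_star/(_ x) Sx; apply: contrapT => Fm.
  have m0 i : i \in x |: S -> m i = 0.
    by move=> iF; apply/eqP; rewrite eqn0Ngt; apply/negP => mi; apply: Fm; exists i.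
  move: Sx; rewrite /star_cond mnmDE ax m0 ?setU11 // subn0.
  apply/negP; rewrite -ltnNge -addn1 -sumc [leqRHS](big_setID S) /= (setIidPr SN).
  apply: leq_trans (leq_addr _ _); apply: leq_sum => i iS.
  by rewrite mnmDE m0 ?setU1r // aS //; have := cs i iS; lia.
case=> i iF mi; pose b := (U_(i) + a)%MM.
have upP := upclosed_pow_set (s := s) (@upclosed_cover_set _ e t).
apply: (upclosed_lem (a := b) upP); last first.
  apply/mnm_lepP => j; rewrite !mnmDE mnm1E leq_add2r.
  by case: eqP => // <-.
apply: star_pow_set => y; rewrite /star_cond.
have b_ge j : a j <= b j by rewrite mnmDE leq_addl.
have [yF|/aF ay] := boolP (y \in x |: S); last first.
  by rewrite big1 // => j _; have := b_ge y; lia.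
move: yF; rewrite in_setU1 => /orP[/eqP->|yS].
  rewrite (big_setID S) /= (setIidPr SN) [X in _ + X]big1 ?addn0; last first.
    move=> j; rewrite !inE => /andP[jS xj]; have := b_ge j; rewrite [a j]aF; first lia.
    by rewrite !inE negb_or jS andbT; apply: contraTneq xj => ->; rewrite e_irr.
  move: iF; rewrite in_setU1 => /orP[/eqP ix|iS].
    have bx : b x = 1 by rewrite mnmDE mnm1E ix eqxx ax.
    have : \sum_(j in S) (s - b x - b j) + #|S| = (t - 1) * s + 1.
      rewrite -sumc -sum1_card -big_split; apply: eq_bigr => j jS /=.
      have xj : x != j by apply: contraTneq jS => <-.
      rewrite bx mnmDE mnm1E ix (negPf xj) aS //; have := cs j jS; lia.
    rewrite bx; move: s_gt0 t_gt0 t_S; set sm := \sum_(_ in _) _.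
    by case: (s) (t) => [|s'] // [|t'] // _ _; nia.
  have ix : i != x by apply: contraTneq iS => ->.
  have bx : b x = 0 by rewrite mnmDE mnm1E (negPf ix) ax.
  rewrite bx subn0 -(leq_add2r 1) -sumc (bigD1 i) // [leqRHS](bigD1 i) //= addnAC.
  apply: leq_add; first by rewrite mnmDE mnm1E eqxx aS //; have := cs i iS; lia.
  apply: leq_sum => j /andP[jS _]; have := b_ge j; rewrite aS //; have := cs j jS.
  by move: (c j) (b j) => *; lia.
have xy := eS y yS.
rewrite (bigD1 x) /= ?inE 1?e_sym // [X in _ + X]big1 ?addn0; last first.
  move=> j; rewrite inE => /andP[yj jx]; have := b_ge j; rewrite [a j]aF; first lia.
  rewrite !inE negb_or jx; apply/negP => jS.
  by have := triangle_free xy (eS j jS); rewrite yj.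
(* If [t = 1] then [S] is reduced to [y], and the remaining term vanishes. *)
have [t_le1|t_gt1] := leqP t 1; last first.
  apply: leq_trans (leq_subr _ _) _; apply: leq_pmull; lia.
suff : s - b y - b x = 0 by move->.
have t1 : t = 1 by apply/eqP; rewrite eqn_leq t_le1.
move: sumc S_ts; rewrite t1 subnn mul0n add0n (bigD1 y) //= => cy /card_le1_eqP S1.
have := b_ge y; have := cs y yS; rewrite aS // => cy_bd b_gey.
move: iF; rewrite in_setU1 => /orP[/eqP ix|iS].
  have : 1 <= b x by rewrite mnmDE mnm1E ix eqxx.
  move: cy b_gey; set r := \sum_(_ in _ | _) _; move: r (c y) (b y) (b x) => *; lia.
have bi : b y = 1 + a y by rewrite mnmDE mnm1E (S1 i y iS yS) eqxx.
rewrite bi aS //; move: cy cy_bd; set r := \sum_(_ in _ | _) _.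
move: r (c y) (b x) => *; lia.
Qed.

End Powers.

(** * Associated primes of the powers and their stability *)

Section AssociatedPrimes.
Import boot.fintype boot.finset.
Local Set Implicit Arguments.
Local Unset Strict Implicit.
Variables (k : fieldType) (n : nat) (e : rel 'I_n) (t : nat).
Hypotheses (t_gt0 : 0 < t) (graph_e : is_simple_graph e) (tree_e : is_tree e).

Let J := partial_cover_ideal k e t.

Lemma ass_pow_partial_cover s P : 0 < s ->
  Ass (ideal_pow J s) P <->
  exists2 F : {set 'I_n}, P = @monomial_ideal n k (hits F) & star_set e t s F.
Proof.
have upC := @upclosed_cover_set _ e t.
move=> s_gt0; rewrite /J partial_cover_idealE ideal_pow_monomial //.
rewrite ass_monomialP; last exact: upclosed_pow_set.
split=> [[F [a [-> witness]]]|[F -> /(witness_of_star_set t_gt0 graph_e tree_e s_gt0)]].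
  by exists F => //; apply: star_set_of_witness witness.
by case=> a; exists F, a.
Qed.

Lemma monomial_ideal_hits_inj :
  injective (fun F : {set 'I_n} => @monomial_ideal n k (hits F)).
Proof.
have memF (F : {set 'I_n}) i : @monomial_ideal n k (hits F) 'X_i <-> i \in F.
  rewrite monomial_idealX; split=> [[j jF]|iF].
    by rewrite mnm1E; case: eqP => // ->.
  by exists i; rewrite // mnm1E eqxx.
move=> F G /= FG; apply/setP => i; apply/idP/idP; rewrite -memF.
  by rewrite FG memF.
by rewrite -FG memF.
Qed.

Lemma card_star_set s (F : {set 'I_n}) : star_set e t s F -> t <= #|F|.-1 <= (t - 1) * s + 1.
Proof.
move=> [x [S [-> SN tS Ss]]]; rewrite cardsU1.
have /negPf-> : x \notin S.
  by apply/negP => /(subsetP SN); rewrite inE; case: graph_e => _ ->.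
by rewrite /= tS.
Qed.

Lemma star_set_mono s s' (F : {set 'I_n}) : (#|F|.-1 <= (t - 1) * s' + 1) ->
  star_set e t s F -> star_set e t s' F.
Proof.
move=> le_s'; move=> [x [S [EF SN tS Ss]]]; exists x, S; split=> //.
suff -> : #|S| = #|F|.-1 by [].
rewrite EF cardsU1.
have -> // : x \notin S.
by apply/negP => /(subsetP SN); rewrite inE; case: graph_e => _ ->.
Qed.

Lemma persistence_partial_cover : persistence_property J.
Proof.
move=> s s_gt0 P /(ass_pow_partial_cover _ s_gt0)[F -> SF].
apply/ass_pow_partial_cover => //; exists F => //.
apply: star_set_mono (SF); have /andP[_ /leq_trans] := card_star_set SF; apply.
by rewrite leq_add2r leq_mul2l leqnSn orbT.
Qed.

(** If [t > 1] and [s0 * (t-1) < max_degree e - 1], the prime generated by a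
    vertex of maximal degree and all its neighbours is associated to some later
    power, but is too large to be associated to the [s0]-th one. *)
Lemma stable_partial_cover s0 : 0 < s0 ->
  (forall s, s0 <= s -> Ass (ideal_pow J s) = Ass (ideal_pow J s0)) <->
  (t = 1 \/ max_degree e - 1 <= s0 * (t - 1)).
Proof.
move=> s0_gt0; split=> [stable|H s s0s]; last first.
  have s_gt0 : 0 < s by apply: leq_trans s0s.
  apply/seteqP; split=> P /ass_pow_partial_cover [//|F -> SF];
    apply/ass_pow_partial_cover => //; exists F => //; apply: star_set_mono (SF).
    case: H => [t1|deg_le].
      by have := card_star_set SF; rewrite t1; lia.
    have [x [S [-> SN tS _]]] := SF; rewrite cardsU1.
    have : #|S| <= max_degree e.
      by apply: leq_trans (subset_leq_card SN) _; apply: (leq_bigmax x).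
    by case: (x \notin S) => /=; nia.
  have /andP[_ /leq_trans] := card_star_set SF; apply.
  by rewrite leq_add2r leq_mul2l s0s orbT.
have [t1|t_ne1] := eqVneq t 1; [by left|right].
have t_gt1 : 1 < t by lia.
rewrite leqNgt; apply/negP => deg_gt.
have [x degx] : exists x, #|neighbours e x| = max_degree e.
  have n_gt0 : 0 < n.
    by case: (n) e deg_gt => // e0; rewrite /max_degree big_ord0.
  have := @bigop.eq_bigmax _ (fun x => #|neighbours e x|).
  by rewrite card_ord => /(_ n_gt0)[x]; exists x.
(* [s >= max_degree e] suffices since [t - 1 >= 1]. *)
pose s := maxn s0 (max_degree e); have s_gt0 : 0 < s by rewrite leq_max s0_gt0.
have SF : star_set e t s (x |: neighbours e x).
  exists x, (neighbours e x); split=> //; rewrite degx; first by nia.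
  have : max_degree e <= s by apply: leq_maxr.
  by nia.
have : Ass (ideal_pow J s) (@monomial_ideal n k (hits (x |: neighbours e x))).
  by apply/ass_pow_partial_cover => //; exists (x |: neighbours e x).
rewrite stable ?leq_maxl // => /(ass_pow_partial_cover _ s0_gt0)[F].
move=> /monomial_ideal_hits_inj <- /card_star_set.
by rewrite cardsU1 !inE graph_e.2 /= degx; nia.
Qed.

End AssociatedPrimes.

Theorem theorem1p2 (k : fieldType) (n : nat) (e : rel 'I_n) (t : nat)
    (graph_e : is_simple_graph e) (tree_e : is_tree e) (t_ge1 : (1 <= t)%N) :
  persistence_property (partial_cover_ideal k e t) /\
  astab (partial_cover_ideal k e t) =
    (if t == 1%N then 1%N
     else min_nat [set s : nat | (1 <= s)%N /\
                                 (max_degree e - 1 <= s * (t - 1))%N]).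
Proof.
split; first exact: persistence_partial_cover.
have stableP := stable_partial_cover k t_ge1 graph_e tree_e.
rewrite /astab; case: eqVneq => [t1|t_ne1]; last first.
  congr min_nat; apply/seteqP; split=> s [s_gt0 Hs]; split=> //.
    by have [t1|] := (stableP s s_gt0).1 Hs; first by rewrite t1 in t_ne1.
  by apply/stableP => //; right.
have A1 := (stableP 1 isT).2 (or_introl t1).
apply: xget_unique => [|m [[m_gt0 _] min_m]].
  by split=> // j [].
by apply/eqP; rewrite eqn_leq m_gt0 min_m.
Qed.
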